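(* The relation $\succcurlyeq$ is a partial order on the set of (isomorphism classes of) non-empty connected graphs; that is, it is reflexive, transitive, and if $H,T$ are non-empty connected graphs with $H\succcurlyeq T$ and $T\succcurlyeq H$, then $H$ and $T$ are isomorphic.
   Context: All graphs are finite, simple and undirected. A graph is non-empty if it has at least one edge. For graphs $H,G$, $\hom(H,G)$ is the number of homomorphisms from $H$ to $G$ (maps $V(H)\to V(G)$ sending edges to edges), and the homomorphism density is $t(H,G)=\hom(H,G)/v(G)^{v(H)}$, where $v(\cdot)$ and $e(\cdot)$ denote numbers of vertices and edges. For non-empty graphs $H,T$, write $H\succcurlyeq T$ if $t(H,G)^{e(T)}\geq t(T,G)^{e(H)}$ for every graph $G$. *)

(* Defs.v *)
From HB Require Import structures.
From mathcomp Require Import all_boot all_order all_algebra.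

Set Implicit Arguments.
Unset Strict Implicit.
Unset Printing Implicit Defensive.

Import Order.TTheory GRing.Theory Num.Theory.

Record sgraph := SGraph {
  vertex :> finType;
  adj : rel vertex;
  adj_sym : symmetric adj;
  adj_irr : irreflexive adj
}.

Definition edges (G : sgraph) : {set {set G}} :=
  [set [set p.1; p.2] | p : G * G & adj p.1 p.2].

Definition num_vertices (G : sgraph) : nat := #|G|.

Definition num_edges (G : sgraph) : nat := #|edges G|.

Definition nonempty_graph (G : sgraph) : Prop := 0 < num_edges G.

(* The graph without vertices satisfies this, but it is not [nonempty_graph]. *)
Definition connected_graph (G : sgraph) : Prop :=
  forall x y : G, connect (@adj G) x y.

Definition nonempty_connected (G : sgraph) : Prop :=
  nonempty_graph G /\ connected_graph G.

Definition isomorphic (H T : sgraph) : Prop :=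
  exists2 f : H -> T, bijective f & forall x y, adj (f x) (f y) = adj x y.

Definition is_hom (H G : sgraph) (f : H -> G) : bool :=
  [forall x, forall y, adj x y ==> adj (f x) (f y)].

Definition num_homs (H G : sgraph) : nat :=
  #|[set f : {ffun H -> G} | is_hom f]|.

Local Open Scope ring_scope.

Definition hom_density (H G : sgraph) : rat :=
  (num_homs H G)%:R / (num_vertices G)%:R ^+ num_vertices H.

(* When G has no vertices and H, T are nonempty, both densities are 0 (as 0 / 0
   is 0 in rat) and both exponents are positive, so that case of the
   quantification over G reads 0 <= 0. *)
Definition dominates (H T : sgraph) : Prop :=
  forall G : sgraph,
    hom_density H G ^+ num_edges T >= hom_density T G ^+ num_edges H.

(* Main.v *)
Require Import Defs.
From HB Require Import structures.
From mathcomp Require Import all_boot all_order all_algebra.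

(** For antisymmetry, evaluate t(H,G)^e(T) = t(T,G)^e(H) on disjoint unions.
    Since H and T are connected with an edge, adding n(G) isolated vertices to G
    doubles the number of vertices and preserves both homomorphism counts, whence
    v(H) e(T) = v(T) e(H); doubling G doubles both homomorphism counts, whence
    e(H) = e(T).  So hom(H,G) = hom(T,G) for every G.  Restricting G to subsets
    of its vertices and inverting, as in Lovász's theorem, H and T have equally
    many homomorphisms with any prescribed image in G.  For G = T there is thus
    a surjective homomorphism from H to T; as both numbers of vertices and of
    edges agree, it is an isomorphism. *)

Set Implicit Arguments.
Unset Strict Implicit.
Unset Printing Implicit Defensive.

Import Order.TTheory GRing.Theory Num.Theory.

(** * Homomorphisms and edge sets *)

Lemma is_homP (H G : sgraph) (f : H -> G) :
  reflect (forall x y, adj x y -> adj (f x) (f y)) (is_hom f).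
Proof.
apply: (iffP forallP) => [hf x y xy | hf x].
  by move/forallP: (hf x) => /(_ y) /implyP; apply.
by apply/forallP => y; apply/implyP; apply: hf.
Qed.

Lemma edgesP (G : sgraph) (e : {set G}) :
  reflect (exists x y, adj x y /\ e = [set x; y]) (e \in edges G).
Proof.
apply: (iffP imsetP) => [[[x y] xy ->] | [x [y [xy ->]]]].
  by exists x, y; split=> //; rewrite inE in xy.
by exists (x, y); rewrite ?inE.
Qed.

Lemma mem_edges (G : sgraph) (x y : G) : ([set x; y] \in edges G) = adj x y.
Proof.
apply/edgesP/idP => [[u [v [uv eq_e]]] | xy]; last by exists x, y.
have neq_uv: u != v by apply: contraTneq uv => ->; rewrite adj_irr.
(* The four memberships leave [(x, y)] equal to [(u, v)] or [(v, u)]; all other cases force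
   [u = v]. *)
have := set21 x y; have := set22 x y; rewrite eq_e !inE.
have := set21 u v; have := set22 u v; rewrite -eq_e !inE.
do 4!case/orP=> /eqP ?; subst=> //; rewrite ?eqxx // in neq_uv *.
by rewrite adj_sym.
Qed.

Lemma imset_set2 (aT rT : finType) (f : aT -> rT) (x y : aT) :
  f @: [set x; y] = [set f x; f y].
Proof. by rewrite imsetU1 imset_set1. Qed.

Lemma imset_edges_sub (H G : sgraph) (f : H -> G) : is_hom f ->
  [set f @: (e : {set H}) | e in edges H] \subset edges G.
Proof.
move/is_homP=> hf; apply/subsetP=> _ /imsetP[_ /edgesP[x [y [xy ->]]] ->].
by rewrite imset_set2 mem_edges hf.
Qed.

Lemma card_imset_edges (H G : sgraph) (f : H -> G) : injective f ->
  #|[set f @: (e : {set H}) | e in edges H]| = num_edges H.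
Proof. by move=> inj_f; rewrite card_imset //; apply: imset_inj. Qed.

Lemma num_edges_inj_hom (H G : sgraph) (f : H -> G) :
  injective f -> is_hom f -> num_edges H <= num_edges G.
Proof.
by move=> inj_f hom_f; rewrite -(card_imset_edges inj_f) subset_leq_card ?imset_edges_sub.
Qed.

(** The images of the edges of [H] are as many as the edges of [G], hence are all of them, so no
    non-edge can be sent to an edge. *)
Lemma bijective_hom_iso (H G : sgraph) (f : H -> G) :
  bijective f -> is_hom f -> num_edges H = num_edges G -> isomorphic H G.
Proof.
move=> bij_f hom_f eqE; exists f => // x y.
have inj_f := bij_inj bij_f.
have /eqP eq_im : [set f @: (e : {set H}) | e in edges H] == edges G.
  by rewrite eqEcard imset_edges_sub // card_imset_edges // eqE leqnn.
rewrite -mem_edges -eq_im -imset_set2 mem_imset ?mem_edges //.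
exact: imset_inj.
Qed.

(** * Invariance under isomorphism *)

Lemma isomorphic_sym (H G : sgraph) : isomorphic H G -> isomorphic G H.
Proof.
case=> f [g fK gK] adj_f; exists g; first by exists f.
by move=> x y; rewrite -adj_f !gK.
Qed.

Lemma num_vertices_iso (H G : sgraph) :
  isomorphic H G -> num_vertices H = num_vertices G.
Proof. by case=> f /bij_eq_card. Qed.

Lemma num_edges_iso (H G : sgraph) : isomorphic H G -> num_edges H = num_edges G.
Proof.
have le (H' G' : sgraph) : isomorphic H' G' -> num_edges H' <= num_edges G'.
  case=> f /bij_inj inj_f adj_f; apply: num_edges_inj_hom inj_f _.
  by apply/is_homP=> x y; rewrite adj_f.
by move=> iso; apply/eqP; rewrite eqn_leq !le //; apply: isomorphic_sym.
Qed.

Lemma num_homs_iso (H H' G : sgraph) :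
  isomorphic H H' -> num_homs H G = num_homs H' G.
Proof.
have le (K K' : sgraph) : isomorphic K K' -> num_homs K' G <= num_homs K G.
  case=> f [g fK gK] adj_f.
  pose F (h : {ffun K' -> G}) := [ffun x => h (f x)].
  have inj_F : injective F.
    by move=> h1 h2 /ffunP eqF; apply/ffunP=> y; have := eqF (g y); rewrite !ffunE gK.
  rewrite /num_homs -(card_imset _ inj_F); apply/subset_leq_card/subsetP.
  move=> _ /imsetP[h + ->]; rewrite !inE => /is_homP hom_h.
  by apply/is_homP=> x y xy; rewrite !ffunE hom_h // adj_f.
by move=> iso; apply/eqP; rewrite eqn_leq !le //; apply: isomorphic_sym.
Qed.

Lemma hom_density_iso (H H' G : sgraph) :
  isomorphic H H' -> hom_density H G = hom_density H' G.
Proof.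
by move=> iso; rewrite /hom_density (num_homs_iso G iso) (num_vertices_iso iso).
Qed.

Lemma dominates_iso (H H' T T' : sgraph) :
  isomorphic H H' -> isomorphic T T' -> dominates H T -> dominates H' T'.
Proof.
move=> isoH isoT domHT G.
rewrite -(num_edges_iso isoH) -(num_edges_iso isoT).
by rewrite -(hom_density_iso G isoH) -(hom_density_iso G isoT).
Qed.

(** * Inequalities between densities *)

Lemma hom_density_ge0 (H G : sgraph) : (0 <= hom_density H G)%R.
Proof. by rewrite divr_ge0 ?exprn_ge0 ?ler0n. Qed.

(** Both sides are raised to the power e(T) > 0; then t(T,G)^(e(U)e(H)) lies between them. *)
Lemma dominates_trans (H T U : sgraph) :
  nonempty_graph T -> dominates H T -> dominates T U -> dominates H U.
Proof.
move=> neT domHT domTU G.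
have ge0 K k : (0 <= hom_density K G ^+ k)%R by rewrite exprn_ge0 ?hom_density_ge0.
have leX k (x y : rat) : (0 <= x -> x <= y -> x ^+ k <= y ^+ k)%R.
  by move=> x0 xy; rewrite lerXn2r ?nnegrE // (le_trans x0).
rewrite -(ler_pXn2r neT) ?nnegrE //.
apply: (@le_trans _ _ (hom_density T G ^+ num_edges U ^+ num_edges H)%R).
  by rewrite [leLHS]exprAC leX.
by rewrite [leLHS]exprAC [leRHS]exprAC leX.
Qed.

(** Clearing denominators in t(H,G)^e(T) = t(T,G)^e(H) moves the argument to natural numbers. *)
Lemma dominates_antisym_num_homs (H T G : sgraph) :
  dominates H T -> dominates T H -> 0 < #|G| ->
  num_homs H G ^ num_edges T * #|G| ^ (num_vertices T * num_edges H) =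
  num_homs T G ^ num_edges H * #|G| ^ (num_vertices H * num_edges T).
Proof.
move=> domHT domTH G_gt0.
have nz k : (#|G|%:R ^+ k != 0 :> rat)%R by rewrite expf_neq0 // pnatr_eq0 -lt0n.
have /eqP : (hom_density H G ^+ num_edges T = hom_density T G ^+ num_edges H)%R.
  by apply/le_anti; rewrite domHT domTH.
rewrite /hom_density !expr_div_n -!exprM eqr_div //.
by rewrite -!natrX -!natrM eqr_nat => /eqP.
Qed.

(** * Connected graphs and disjoint copies *)

Lemma nonempty_graph_edge (H : sgraph) :
  nonempty_graph H -> exists x y : H, adj x y.
Proof. by case/card_gt0P=> e /edgesP[x [y [xy _]]]; exists x, y. Qed.

Lemma nonempty_connected_adj (H : sgraph) (x : H) :
  nonempty_connected H -> exists y, adj x y.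
Proof.
case=> /nonempty_graph_edge[u [v uv]] conH.
case/connectP: (conH x u) => [[|y p]] /=; first by move=> _ <-; exists v.
by case/andP=> xy _ _; exists y.
Qed.

Section Copies.

Variables (I : finType) (A : {set I}) (G : sgraph).

Definition copies_adj : rel (I * G) :=
  fun p q => [&& p.1 == q.1, p.1 \in A & adj p.2 q.2].

Lemma copies_adj_sym : symmetric copies_adj.
Proof.
move=> [i x] [j y]; rewrite /copies_adj /= eq_sym adj_sym.
by case: eqP => [->|].
Qed.

Lemma copies_adj_irr : irreflexive copies_adj.
Proof. by move=> p; rewrite /copies_adj adj_irr !andbF. Qed.

(* One copy of G for each element of A, and n(G) isolated vertices for each
   element of I outside A. *)
Definition copies : sgraph := SGraph copies_adj_sym copies_adj_irr.

(** Along a path the index of the copy is constant, so connectedness puts the image of [H] in one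
    copy; an edge of [H] forces its index into [A]. *)
Lemma num_homs_copies (H : sgraph) :
  nonempty_connected H -> num_homs H copies = #|A| * num_homs H G.
Proof.
move=> [neH conH]; have [u [v uv]] := nonempty_graph_edge neH.
pose F (p : I * {ffun H -> G}) : {ffun H -> copies} := [ffun x => (p.1, p.2 x)].
have inj_F : injective F.
  move=> [i f] [j g] /ffunP eqF; have := eqF u; rewrite !ffunE => -[-> _].
  by congr pair; apply/ffunP=> x; have := eqF x; rewrite !ffunE => -[].
rewrite /num_homs -cardsX -(card_imset _ inj_F); congr #|pred_of_set _|.
apply/setP=> g; rewrite inE; apply/is_homP/imsetP => [hom_g | [[i f]]].
  have fst_const x : (g x).1 = (g u).1.
    have /connectP[p] := conH u x; elim/last_ind: p x => [x _ -> //|p y IHp x].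
    rewrite rcons_path last_rcons => /andP[pathp py] ->.
    by have /and3P[/eqP <- _ _] := hom_g _ _ py; apply: IHp.
  exists ((g u).1, [ffun x => (g x).2]); last first.
    by apply/ffunP=> x; rewrite !ffunE -(fst_const x) -surjective_pairing.
  rewrite !inE /=; have /and3P[_ -> _] /= := hom_g _ _ uv.
  by apply/is_homP=> x y /hom_g /and3P[_ _]; rewrite !ffunE.
rewrite !inE /= => /andP[Ai /is_homP hom_f] -> x y xy.
by rewrite !ffunE /= /copies_adj /= eqxx Ai hom_f.
Qed.

Lemma card_copies : #|copies| = #|I| * #|G|.
Proof. exact: card_prod. Qed.

End Copies.

(** * Counting homomorphisms by image *)

Section Restrict.

Variables (G : sgraph) (S : {set G}).

Definition restrict_adj : rel G := fun x y => [&& x \in S, y \in S & adj x y].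

Lemma restrict_adj_sym : symmetric restrict_adj.
Proof. by move=> x y; rewrite /restrict_adj adj_sym andbCA. Qed.

Lemma restrict_adj_irr : irreflexive restrict_adj.
Proof. by move=> x; rewrite /restrict_adj adj_irr !andbF. Qed.

(* The vertices outside S are kept but isolated, so that homomorphisms into
   subgraphs of G all have the same type. *)
Definition restrict : sgraph := SGraph restrict_adj_sym restrict_adj_irr.

End Restrict.

Definition num_homs_onto (H G : sgraph) (S : {set G}) : nat :=
  #|[set f : {ffun H -> G} | is_hom f && (f @: setT == S)]|.

(** Every vertex of [H] lies on an edge, so it cannot be sent to an isolated vertex outside [S]. The
    homomorphisms are then sorted by image. *)
Lemma num_homs_restrict (H G : sgraph) (S : {set G}) : nonempty_connected H ->
  num_homs H (restrict S) = \sum_(S' : {set G} | S' \subset S) num_homs_onto H S'.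
Proof.
move=> ncH; pose im (f : {ffun H -> G}) := f @: setT.
transitivity #|[set f : {ffun H -> G} | is_hom f && (im f \subset S)]|.
  apply: eq_card => f; rewrite !inE.
  apply/is_homP/andP => [hom_f | [/is_homP hom_f /subsetP sfS] x y xy].
    split; first by apply/is_homP=> x y /hom_f /and3P[].
    apply/subsetP=> _ /imsetP[x _ ->]; have [y xy] := nonempty_connected_adj x ncH.
    by have /and3P[] := hom_f _ _ xy.
  by rewrite /= /restrict_adj !sfS ?imset_f ?hom_f.
rewrite -sum1_card (partition_big im (fun S' => S' \subset S)) => [|f]; last first.
  by rewrite inE => /andP[].
apply: eq_bigr => S' sS'S; rewrite sum1dep_card; apply: eq_card => f; rewrite !inE.
by rewrite -andbA; case: eqP => [->|]; rewrite ?sS'S ?andbF.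
Qed.

(** The sums over subsets form a triangular system: by induction on the size of [S] all terms but
    the one at [S] itself cancel. *)
Lemma num_homs_onto_eq (H T G : sgraph) (S : {set G}) :
  nonempty_connected H -> nonempty_connected T ->
  (forall S' : {set G}, num_homs H (restrict S') = num_homs T (restrict S')) ->
  num_homs_onto H S = num_homs_onto T S.
Proof.
move=> ncH ncT eq_homs.
have [n] := ubnP #|S|; elim: n S => // n IHn S ltSn.
have := eq_homs S; rewrite !num_homs_restrict //.
rewrite (bigD1 S) // [RHS](bigD1 S) //=.
rewrite (eq_bigr (fun S' => num_homs_onto T S')) => [|S' /andP[sS'S neS'S]].
  exact: addIn.
by apply: IHn; rewrite -ltnS (leq_trans _ ltSn) // ltnS proper_card // properEneq neS'S.
Qed.

Lemma num_homs_refl (H : sgraph) : 0 < num_homs H H.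
Proof.
by apply/card_gt0P; exists [ffun x => x]; rewrite inE; apply/is_homP=> x y; rewrite !ffunE.
Qed.

(** * Antisymmetry *)

Lemma dominates_antisym_sizes (H T : sgraph) :
  nonempty_connected H -> nonempty_connected T ->
  dominates H T -> dominates T H ->
  num_edges H = num_edges T /\ num_vertices H = num_vertices T.
Proof.
move=> ncH ncT domHT domTH; have [neH _] := ncH; have [neT _] := ncT.
have H_gt0 : 0 < #|H|.
  by have [x _] := nonempty_graph_edge neH; apply/card_gt0P; exists x.
have eqH := dominates_antisym_num_homs domHT domTH.
set a := num_edges T in eqH *; set b := num_edges H in eqH *.
set v := num_vertices H in eqH *; set w := num_vertices T in eqH *.
(* This is [eqH] at [copies A H], with the factors coming from [eqH] at [H] collected into one
   common factor. *)
have eq2 (A : {set bool}) :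
    #|A| ^ a * 2 ^ (w * b) * (num_homs H H ^ a * #|H| ^ (w * b)) =
    #|A| ^ b * 2 ^ (v * a) * (num_homs H H ^ a * #|H| ^ (w * b)).
  rewrite [in RHS]eqH // mulnACA -!expnMn [RHS]mulnACA -!expnMn.
  have := eqH (copies A H).
  by rewrite card_copies card_bool !num_homs_copies //; apply; rewrite muln_gt0.
have pos : 0 < num_homs H H ^ a * #|H| ^ (w * b).
  by rewrite muln_gt0 !expn_gt0 num_homs_refl H_gt0.
have eq_wv : w * b = v * a.
  (* One copy of [H] plus isolated vertices: only the powers of 2 remain. *)
  have /eqP := eq2 [set true]; rewrite eqn_pmul2r // cards1 !exp1n !mul1n.
  by rewrite eqn_exp2l // => /eqP.
have eq_ab : a = b.
  (* Two copies of [H]: what remains is 2^a = 2^b. *)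
  have /eqP := eq2 setT; rewrite eqn_pmul2r // eq_wv eqn_pmul2r ?expn_gt0 //.
  by rewrite cardsT card_bool eqn_exp2l // => /eqP.
split=> //; apply/eqP; rewrite -(@eqn_pmul2r a) //.
by rewrite -eq_wv eq_ab.
Qed.

Lemma dominates_antisym_num_homs_eq (H T G : sgraph) :
  nonempty_connected H -> nonempty_connected T ->
  dominates H T -> dominates T H -> 0 < #|G| -> num_homs H G = num_homs T G.
Proof.
move=> ncH ncT domHT domTH G_gt0.
have [eqE eqV] := dominates_antisym_sizes ncH ncT domHT domTH.
have /eqP := dominates_antisym_num_homs domHT domTH G_gt0.
have [neT _] := ncT; rewrite eqE eqV eqn_pmul2r ?expn_gt0 ?G_gt0 //.
by rewrite eqn_exp2r // => /eqP.
Qed.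

Lemma dominates_antisym (H T : sgraph) :
  nonempty_connected H -> nonempty_connected T ->
  dominates H T -> dominates T H -> isomorphic H T.
Proof.
move=> ncH ncT domHT domTH.
have [eqE eqV] := dominates_antisym_sizes ncH ncT domHT domTH.
have T_gt0 : 0 < #|T|.
  have [neT _] := ncT.
  by have [x _] := nonempty_graph_edge neT; apply/card_gt0P; exists x.
have : 0 < num_homs_onto H [set: T].
  rewrite (num_homs_onto_eq _ ncH ncT) => [|S]; last first.
    (* [restrict S] keeps all vertices of [T], so it has a vertex even for empty [S]. *)
    exact: dominates_antisym_num_homs_eq.
  apply/card_gt0P; exists [ffun x => x]; rewrite inE; apply/andP; split.
    by apply/is_homP=> x y; rewrite !ffunE.
  by apply/eqP/setP=> x; rewrite inE; apply/imsetP; exists x; rewrite ?ffunE.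
case/card_gt0P=> f; rewrite inE => /andP[hom_f /eqP onto_f].
have inj_f : injective f.
  (* A surjection between finite sets of equal size is injective. *)
  apply/injectiveP/card_uniqP; rewrite size_image -[LHS]cardsE -/(num_vertices H) eqV.
  rewrite /num_vertices -cardsT -onto_f; apply: eq_card => y; rewrite inE.
  by apply/imageP/imsetP=> -[x _ ->]; exists x.
apply: bijective_hom_iso hom_f eqE.
by apply: inj_card_bij inj_f _; rewrite -/(num_vertices H) eqV.
Qed.

(* The first conjunct says that the relation descends to isomorphism classes. *)
Theorem theorem1p1 :
  [/\ forall H H' T T' : sgraph,
        nonempty_connected H -> nonempty_connected H' ->
        nonempty_connected T -> nonempty_connected T' ->
        isomorphic H H' -> isomorphic T T' ->
        dominates H T -> dominates H' T',
      forall H : sgraph, nonempty_connected H -> dominates H H,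
      forall H T U : sgraph,
        nonempty_connected H -> nonempty_connected T -> nonempty_connected U ->
        dominates H T -> dominates T U -> dominates H U
    & forall H T : sgraph,
        nonempty_connected H -> nonempty_connected T ->
        dominates H T -> dominates T H -> isomorphic H T].
Proof.
split.
- by move=> H H' T T' _ _ _ _; apply: dominates_iso.
- by move=> H _ G; apply: lexx.
- by move=> H T U _ [neT _] _; apply: dominates_trans.
- exact: dominates_antisym.
Qed.
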